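(* Let $N\ge1$, let $\mu\in(0,1)$, and let $\tilde H\in\mathbb{R}^{\mathcal I_N\times\mathcal I_N}$ be the strictly lower triangular matrix representing $N$ steps of ITEM, with $\tilde H^A$ its antitranspose (the H-dual of ITEM). Then for every $d\ge 1$, every $1$-smooth $\mu$-strongly convex function $h:\mathbb{R}^d\to\mathbb{R}$ and every $y_0\in\mathbb{R}^d$, the iterates $$y_n=y_{n-1}-\sum_{i=0}^{n-1}(\tilde H^A)_{n,i}\nabla h(y_i),\qquad n=1,\dots,N,$$ satisfy $$\|\nabla h(y_N)\|^2\le\frac1{1+\mu A_N}\|\nabla h(y_0)\|^2 .$$
   Context: $\mathcal I_N=\{0,\dots,N\}$ indexes rows and columns. The antitranspose is $X^A=RX^\intercal R$ with $R$ the reversal permutation matrix (ones on the antidiagonal), i.e. $(X^A)_{i,j}=X_{N-j,N-i}$. Define $A_0=0$ and, for $k\ge0$, $$A_{k+1}=\frac{(1+\mu)A_k+2\left(1+\sqrt{(1+A_k)(1+\mu A_k)}\right)}{(1-\mu)^2},\quad \beta_k=\frac{A_k}{(1-\mu)A_{k+1}},\quad \delta_k=\sqrt{\frac{A_{k+1}}{1+\mu A_{k+1}}}.$$ ITEM (with smoothness constant $1$), with oracle responses $s_k=\nabla h(y_k)$, is: $z_0=y_0$ and for $k=0,\dots,N-1$, $$y_k=(1-\beta_k)z_k+\beta_kx_{k-1}\ \ (\text{for }k\ge1),\qquad x_k=y_k-s_k,\qquad z_{k+1}=(1-\mu\delta_k)z_k+\mu\delta_ky_k-\delta_ks_k,$$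 and its output is $z_N$. As a fixed-step first-order method its iterates are $y_0,\dots,y_{N-1}$ together with final iterate $y_N:=z_N$. The matrix $\tilde H$ is the unique strictly lower triangular matrix for which, as formal linear identities in $y_0,s_0,\dots,s_{N-1}$, these iterates satisfy $y_n=y_{n-1}-\sum_{i=0}^{n-1}\tilde H_{n,i}s_i$ for $n=1,\dots,N$. *)

(* Defs.v *)
From HB Require Import structures.
From mathcomp Require Import all_boot all_order all_algebra.
From mathcomp Require Import all_classical all_reals all_analysis.
From mathcomp Require Import ring.

Set Implicit Arguments.
Unset Strict Implicit.
Unset Printing Implicit Defensive.

Import Order.TTheory GRing.Theory Num.Theory.
Import numFieldNormedType.Exports.

Local Open Scope classical_set_scope.
Local Open Scope ring_scope.

(* The library norm `|x| on 'rV[R]_d is the sup norm, hence this definition.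
   The two norms induce the same topology, so that the library notion
   [differentiable] is unaffected. *)
Definition enorm (R : realType) (d : nat) (x : 'rV[R]_d) : R :=
  Num.sqrt (\sum_(i < d) x 0 i ^+ 2).

Definition grad (R : realType) (d : nat) (h : 'rV[R]_d -> R) (x : 'rV[R]_d)
    : 'rV[R]_d :=
  \row_(i < d) 'D_(delta_mx 0 i) h x.

Definition smooth (R : realType) (d : nat) (L : R) (h : 'rV[R]_d -> R) : Prop :=
  (forall x, differentiable h x) /\
  (forall x y, enorm (grad h x - grad h y) <= L * enorm (x - y)).

Definition strongly_convex (R : realType) (d : nat) (mu : R)
    (h : 'rV[R]_d -> R) : Prop :=
  convex_function [set: 'rV[R]_d] (fun x => h x - mu / 2 * enorm x ^+ 2).

Definition antitr (R : realType) (N : nat) (X : 'M[R]_N.+1) : 'M[R]_N.+1 :=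
  \matrix_(i, j) X (rev_ord j) (rev_ord i).

Definition strictly_lower (R : realType) (N : nat) (H : 'M[R]_N.+1) : Prop :=
  forall i j : 'I_N.+1, (i <= j)%N -> H i j = 0.

(* The sequence y is generated by the N-step fixed-step first-order method
   with step matrix H and oracle responses g; only y_0, ..., y_N and
   g_0, ..., g_{N-1} matter. *)
Definition fsfom_iterates (R : realType) (V : lmodType R) (N : nat)
    (H : 'M[R]_N.+1) (g y : nat -> V) : Prop :=
  forall n : 'I_N.+1, (0 < n)%N ->
    y n = y n.-1 - \sum_(i < N.+1 | (i < n)%N) H n i *: g i.

Fixpoint itemA (R : realType) (mu : R) (k : nat) : R :=
  if k is k'.+1 then
    let a := itemA mu k' in
    ((1 + mu) * a + 2 * (1 + Num.sqrt ((1 + a) * (1 + mu * a))))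
      / (1 - mu) ^+ 2
  else 0.

Definition item_beta (R : realType) (mu : R) (k : nat) : R :=
  itemA mu k / ((1 - mu) * itemA mu k.+1).

Definition item_delta (R : realType) (mu : R) (k : nat) : R :=
  Num.sqrt (itemA mu k.+1 / (1 + mu * itemA mu k.+1)).

(* The pair (y_k, z_k). *)
Fixpoint item_yz (R : realType) (mu : R) (V : lmodType R) (y0 : V)
    (s : nat -> V) (k : nat) : V * V :=
  if k is j.+1 then
    let: (y, z) := item_yz mu y0 s j in
    let x := y - s j in
    let z' := (1 - mu * item_delta mu j) *: z
              + (mu * item_delta mu j) *: y - item_delta mu j *: s j in
    ((1 - item_beta mu j.+1) *: z' + item_beta mu j.+1 *: x, z')
  else (y0, y0).

(* The iterates of N-step ITEM as a fixed-step first-order method: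
   y_0, ..., y_{N-1} followed by the output z_N. *)
Definition item_iterate (R : realType) (mu : R) (N : nat) (V : lmodType R)
    (y0 : V) (s : nat -> V) (n : nat) : V :=
  if (n < N)%N then (item_yz mu y0 s n).1 else (item_yz mu y0 s N).2.

(* The free module on y_0, s_0, ..., s_{N-1} is 'rV[R]_N.+1, where the basis
   vector 0 stands for y_0 and the basis vector i + 1 for s_i, i < N. *)
Definition formal_y0 (R : realType) (N : nat) : 'rV[R]_N.+1 := delta_mx 0 ord0.
Definition formal_s (R : realType) (N : nat) (i : nat) : 'rV[R]_N.+1 :=
  delta_mx 0 (inord i.+1).

Definition item_matrix (R : realType) (mu : R) (N : nat) (H : 'M[R]_N.+1)
    : Prop :=
  strictly_lower H /\
  fsfom_iterates H (formal_s R N)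
    (item_iterate mu N (formal_y0 R N) (formal_s R N)).

Lemma item_yz_coef (R : realType) (mu : R) (N n : nat) : (n <= N)%N ->
  let p := item_yz mu (formal_y0 R N) (formal_s R N) n in
  [/\ p.1 0 0 = 1, p.2 0 0 = 1 &
      forall j : 'I_N.+1, (n < j)%N -> p.1 0 j = 0 /\ p.2 0 j = 0].
Proof.
elim: n => [_|n IH nN] /=.
  by split=> [||j j0]; rewrite ?mxE ?eqxx //= -val_eqE /= gtn_eqF.
have := IH (ltnW nN); case: item_yz => y z /= [y1 z1 c].
have s0 (j : 'I_N.+1) : (j != n.+1 :> nat) -> formal_s R N n 0 j = 0.
  move=> jn; rewrite mxE eqxx /= -val_eqE /= inordK ?ltnS //.
  by rewrite (negbTE jn).
move: (formal_s R N n) s0 => s s0.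
split; first by rewrite !mxE !s0 // y1 z1; ring.
  by rewrite !mxE !s0 // y1 z1; ring.
move=> j nj; have [yj zj] := c j (ltnW nj).
have sj : s 0 j = 0 by apply: s0; rewrite gtn_eqF.
by rewrite !mxE !sj yj zj; split; ring.
Qed.

Lemma item_iterate_coef (R : realType) (mu : R) (N n : nat) : (n <= N)%N ->
  let y := item_iterate mu N (formal_y0 R N) (formal_s R N) n in
  y 0 0 = 1 /\ forall j : 'I_N.+1, (n < j)%N -> y 0 j = 0.
Proof.
move=> nN; rewrite /item_iterate; case: ltnP => [lt|Nn].
  by have [y1 _ c] := item_yz_coef mu nN; split=> // j /c[].
have [_ z1 c] := item_yz_coef mu (leqnn N); split=> // j nj.
by apply: (c j _).2; apply: leq_ltn_trans nj.
Qed.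

Lemma sum_formal_s (R : realType) (N n : nat) (a : 'I_N.+1 -> R)
    (j : 'I_N.+1) : (n <= N)%N ->
  (\sum_(i < N.+1 | (i < n)%N) a i *: formal_s R N i) 0 j
    = if (0 < j <= n)%N then a (inord j.-1) else 0.
Proof.
move=> nN; rewrite summxE.
have E (i : 'I_N.+1) : (i < n)%N ->
    (a i *: formal_s R N i) 0 j = if i.+1 == j :> nat then a i else 0.
  move=> i_n; rewrite !mxE eqxx /= -val_eqE /= inordK; last first.
    by rewrite ltnS (leq_trans i_n).
  by rewrite eq_sym; case: eqP => _; rewrite ?mulr1 ?mulr0.
rewrite (eq_bigr _ E); case: ifPn => [/andP[j0 jn]|nj].
  have jK : (inord j.-1 : 'I_N.+1) = j.-1 :> nat.
    by rewrite inordK // (leq_ltn_trans (leq_pred _)).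
  rewrite (bigD1 (inord j.-1)) ?jK ?prednK //= eqxx big1 ?addr0 // => i.
  case/andP => _; rewrite -val_eqE /= jK => ij; case: eqP => // ej.
  by rewrite -ej eqxx in ij.
rewrite big1 // => i i_n; case: eqP => // ij.
by rewrite -ij /= i_n in nj.
Qed.

(* Exactly one matrix satisfies [item_matrix]. *)
Lemma item_matrix_exists (R : realType) (mu : R) (N : nat) :
  exists H : 'M[R]_N.+1, item_matrix mu H.
Proof.
pose y := item_iterate mu N (formal_y0 R N) (formal_s R N).
exists (\matrix_(n, i) if (i < n)%N then (y n.-1 - y n) 0 (inord i.+1) else 0).
split=> [i j ij|n n0]; first by rewrite mxE ltnNge ij.
rewrite -/y; apply/rowP => j; rewrite !mxE.
have nN : (n <= N)%N by rewrite -ltnS.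
rewrite sum_formal_s //; have [yn1 ynj] := item_iterate_coef mu nN.
have [yp1 ypj] := item_iterate_coef mu (leq_trans (leq_pred n) nN).
case: ifPn => [/andP[j0 jn]|].
  have jK : (inord j.-1 : 'I_N.+1) = j.-1 :> nat.
    by rewrite inordK // (leq_ltn_trans (leq_pred _)).
  rewrite mxE jK prednK // jn inord_val !mxE; ring.
rewrite negb_and -eqn0Ngt -ltnNge => /orP[/eqP j0|nj].
  by rewrite (_ : j = 0) ?subr0; [rewrite yn1 yp1 | exact: val_inj].
by rewrite ynj // ypj ?subr0 // (leq_ltn_trans (leq_pred _)).
Qed.

Lemma item_matrix_unique (R : realType) (mu : R) (N : nat)
    (H1 H2 : 'M[R]_N.+1) : item_matrix mu H1 -> item_matrix mu H2 -> H1 = H2.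
Proof.
move=> [L1 E1] [L2 E2]; apply/matrixP => n i.
have [ni|i_n] := leqP n i; first by rewrite L1 // L2.
have n0 : (0 < n)%N by apply: leq_ltn_trans i_n.
have nN : (n <= N)%N by rewrite -ltnS.
have iK : (inord i.+1 : 'I_N.+1) = i.+1 :> nat.
  by rewrite inordK // ltnS (leq_trans i_n).
have := E1 n n0; rewrite {1}(E2 n n0) => /addrI/oppr_inj.
move=> /rowP/(_ (inord i.+1)); rewrite !sum_formal_s // iK i_n /=.
by rewrite inord_val.
Qed.

(* Main.v *)
Require Import Defs.
From HB Require Import structures.
From mathcomp Require Import all_boot all_order all_algebra.
From mathcomp Require Import all_classical all_reals all_analysis.
From mathcomp Require Import ring lra.

Import Order.TTheory GRing.Theory Num.Theory.
Import numFieldNormedType.Exports.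

Local Open Scope ring_scope.

(** Write [g_t] for the gradient of [h] at [y_t], [A_k] for [itemA mu k] and
    [sigma = mu / (1 - mu)].  Three ideas combine.

    Change of variables.  A 1-smooth, [mu]-strongly convex [h] is the Moreau
    envelope of a [sigma]-strongly convex function [phi]: the point
    [x_t = y_t - g_t] is the proximal point of [y_t], the value of [phi] there
    is [F_t = h(y_t) - |g_t|^2 / 2], and [g_t] is a subgradient of [phi] at
    [x_t].  All that the proof uses about [h] is the resulting inequality
    [F_s >= F_t + <g_t, x_s - x_t> + sigma/2 |x_s - x_t|^2] ([interpolation]).

    Time reversal.  For [m <= k], the entry of the step matrix of ITEM in row
    [k + 1] and column [m] is
    [[k = m] + fresh_k (delta_m - 1) prod_(m < j <= k) carry_j].
    Antitransposition exchanges the factors [fresh_k] and [delta_m - 1] and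
    reverses time, so that the dual method is again a momentum method,
    [y_{t+1} = x_t - (delta_{N-t-1} - 1) G_t], where
    [G_{t+1} = (1 - beta_k) g_{t+1} + beta_k (1 - mu delta_k) G_t] with
    [k = N - t - 1] ([antitr_item_sum]).

    Lyapunov function.  Up to the shift by [sigma x_t], the vector [G_t] is an
    average of subgradients: for [t < N], [G_t - sigma x_t] is the mean of the
    subgradients [g_s - sigma x_s], [s <= t], of the convex function
    [phi - sigma/2 |.|^2], with weights equal to the increments of
    [1 / A_{N-s}] ([mix_average]).  With the weights
    [w_k = (1 - mu) / (4 (1 + mu A_k))] the quantity
    [w_{N-t} |G_t|^2 + (1 / A_{N-t}) (F_t - F_N - <G_t, x_t - x_N>
       + sigma/2 |x_t - x_N|^2)]
    does not increase with [t]: the change of its first term is an exact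
    multiple of [<G_t - g_{t+1}, D> - sigma |D|^2] with [D = x_t - x_{t+1}]
    ([energy_balance], which holds because of the quadratic equation that
    defines [A_{k+1}]), and the rest is the interpolation inequality for the
    pairs [(t, t+1)] and [(N, t+1)].  Initially [G_0 = g_0] and the
    parenthesis is nonpositive; finally [A_0 = 0] makes [G_N = g_N] and the
    parenthesis vanishes.  The ratio [w_0 / w_N] is [1 + mu A_N]. *)

Set Implicit Arguments.
Unset Strict Implicit.
Unset Printing Implicit Defensive.

(** * Euclidean inner product *)

Section InnerProduct.
Variables (R : realType) (d : nat).
Implicit Types u v w : 'rV[R]_d.

Definition dot u v : R := \sum_(i < d) u 0 i * v 0 i.

Lemma enorm_sqr u : enorm u ^+ 2 = dot u u.
Proof.
rewrite /enorm sqr_sqrtr; first by apply: eq_bigr => i _; rewrite expr2.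
by apply: sumr_ge0 => i _; exact: sqr_ge0.
Qed.

Lemma dot_ge0 u : 0 <= dot u u.
Proof. by rewrite -enorm_sqr sqr_ge0. Qed.

Lemma dotC u v : dot u v = dot v u.
Proof. by apply: eq_bigr => i _; rewrite mulrC. Qed.

Lemma dotDl u v w : dot (u + v) w = dot u w + dot v w.
Proof. by rewrite -big_split; apply: eq_bigr => i _; rewrite mxE mulrDl. Qed.

Lemma dotZl a u w : dot (a *: u) w = a * dot u w.
Proof. by rewrite mulr_sumr; apply: eq_bigr => i _; rewrite mxE mulrA. Qed.

Lemma dotNl u w : dot (- u) w = - dot u w.
Proof. by rewrite -scaleN1r dotZl mulN1r. Qed.

Lemma dotDr u v w : dot w (u + v) = dot w u + dot w v.
Proof. by rewrite dotC dotDl !(dotC w). Qed.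

Lemma dotZr a u w : dot w (a *: u) = a * dot w u.
Proof. by rewrite dotC dotZl (dotC w). Qed.

Lemma dotNr u w : dot w (- u) = - dot w u.
Proof. by rewrite dotC dotNl (dotC w). Qed.

Definition dotE := (dotDl, dotDr, dotNl, dotNr, dotZl, dotZr).

End InnerProduct.

(** * The interpolation inequality *)

Section Interpolation.
Local Open Scope classical_set_scope.

Variables (R : realType) (d : nat) (mu : R) (h : 'rV[R]_d -> R).
Hypotheses (hmu1 : mu < 1).
Hypotheses (hsmooth : smooth 1 h) (hconvex : strongly_convex mu h).
Implicit Types u v w x y : 'rV[R]_d.

Lemma derive_grad v w : 'D_w h v = dot (grad h v) w.
Proof.
have dh := hsmooth.1.
rewrite deriveE // [in LHS](row_sum_delta w) linear_sum /=.
by apply: eq_bigr => i _; rewrite linearZ /= mxE deriveE // mulrC.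
Qed.

Lemma is_derive_line v w (t : R) :
  is_derive t 1 (fun t : R => h (v + t *: w)) (dot (grad h (v + t *: w)) w).
Proof.
have dh : derivable h (v + t *: w) w by apply: diff_derivable; exact: hsmooth.1.
have E : (fun s : R =>
            s^-1 *: (((fun t : R => h (v + t *: w)) \o shift t) (s *: 1)
            - h (v + t *: w)))
       = (fun s : R => s^-1 *: ((h \o shift (v + t *: w)) (s *: w)
            - h (v + t *: w))).
  apply/funext => s /=; congr (_ *: (h _ - _)).
  by rewrite [_%:A]mulr1 scalerDl addrCA addrA addrC addrA.
split; first by rewrite /derivable E.
by rewrite -derive_grad /derive E.
Qed.

(** By the mean value theorem along the segment from [v] to [v + w], since
    the Lipschitz bound makes the derivative of
    [t |-> h (v + t w) - t <grad h v, w> - t^2/2 |w|^2] nonpositive. *)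
Lemma descent v w :
  h (v + w) <= h v + dot (grad h v) w + 2^-1 * dot w w.
Proof.
pose f (t : R) := h (v + t *: w) - (t * dot (grad h v) w + 2^-1 * t ^+ 2 * dot w w).
pose df (t : R) :=
  dot (grad h (v + t *: w)) w - (dot (grad h v) w + t * dot w w).
have fd (t : R) : is_derive t 1 f (df t).
  have H1 := is_derive_line v w t.
  apply: is_derive_eq.
  by rewrite /df /GRing.scale /=; field.
have fc : {within `[0, 1], continuous f}.
  by apply: derivable_within_continuous => x _; have [] := fd x.
have [c c01 E] := MVT (ltr01 : (0 : R) < 1) (fun t _ => fd t) fc.
move: c01; rewrite in_itv /= => /andP[c0 c1].
have dfc : df c <= 0.
  rewrite /df; set g := grad h _; set g0 := grad h v.
  have L : dot (g - g0) (g - g0) <= c ^+ 2 * dot w w.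
    have := hsmooth.2 (v + c *: w) v.
    rewrite mul1r [v + _]addrC addrK -[c *: w + v]addrC -/g -/g0.
    rewrite -(@ler_pXn2r _ 2) // ?nnegrE ?sqrtr_ge0 //.
    rewrite !enorm_sqr !dotE; lra.
  (* Together with [L] this gives [c <g - g0, w> <= c^2 |w|^2]. *)
  have P := dot_ge0 (g - g0 - c *: w).
  have : c * (dot g w - (dot g0 w + c * dot w w)) <= 0.
    move: L P; rewrite !dotE !(dotC w) (dotC g0 g); lra.
  by rewrite pmulr_rle0.
move: E; rewrite /f /= scale1r scale0r addr0 => E.
lra.
Qed.

(** The chord inequality of the convex function [h - mu/2 |.|^2], divided by the
    step length [t], passes to the limit as [t] tends to 0 from the right. *)
Lemma strong_convexity_grad v w :
  h v + dot (grad h v) w + mu / 2 * dot w w <= h (v + w).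
Proof.
have C (t : R) : 0 < t -> t < 1 ->
    t^-1 * (h (v + t *: w) - h v)
      <= h (v + w) - h v - mu / 2 * dot w w + t * (mu / 2 * dot w w).
  move=> t0 t1.
  have t01 : 0 <= t /\ t <= 1 by split; exact: ltW.
  have := hconvex (Itv01 t01.1 t01.2) (in_setT (v + w)) (in_setT v).
  rewrite convRE /conv /= /unstable.onem !enorm_sqr.
  have -> : t *: (v + w) + (1 - t) *: v = v + t *: w.
    by rewrite scalerDr scalerBl scale1r addrC addrA subrK.
  rewrite !dotE !(dotC v w) => H.
  rewrite mulrC ler_pdivrMr //; lra.
have [dv lv] := is_derive_line v w 0.
have q_l : (s : R)^-1 * (h (v + s *: w) - h v) @[s --> 0^'+] --> dot (grad h v) w.
  apply: cvg_dnbhs_at_right; move: dv lv; rewrite /derivable /derive scale0r addr0.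
  by under eq_fun do rewrite /= addr0 [_%:A]mulr1; move=> dv <-.
suff : dot (grad h v) w <= h (v + w) - h v - mu / 2 * dot w w by lra.
apply: (ler_cvg_to q_l); last first.
  near=> t; apply: C; near: t; [exact: nbhs_right_gt|exact: nbhs_right_lt].
set c := h (v + w) - _ - _; set e := mu / 2 * _.
suff : c + t * e @[t --> (0 : R)^'+] --> c + 0 * e by rewrite mul0r addr0.
by apply: cvg_at_right_filter; apply: cvgD; [exact: cvg_cst|apply: cvgMl].
Unshelve. all: by end_near. Qed.

(** The proximal point of [y], and the proximal function at that point, when
    [h] is regarded as a Moreau envelope. *)
Definition prox y := y - grad h y.
Definition prox_value y := h y - 2^-1 * dot (grad h y) (grad h y).

(** Strong convexity between [y] and an auxiliary point [x - p], and smoothness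
    between [x - p] and [x], bound [h (x - p)] on both sides.  The shift
    [p = (grad h x - grad h y - mu (x - y)) / (1 - mu)] minimizes the upper bound
    minus the lower bound; in terms of the proximal points the result is
    strong convexity of the proximal function with modulus
    [mu / (1 - mu)]. *)
Lemma interpolation x y (D := prox x - prox y) :
  0 <= prox_value x - prox_value y - dot (grad h y) D
       - mu / (2 * (1 - mu)) * dot D D.
Proof.
rewrite {}/D /prox_value /prox.
have m1 : 1 - mu != 0 by rewrite subr_eq0 eq_sym lt_eqF.
set a := grad h x; set b := grad h y.
pose e := x - y; pose p := (1 - mu)^-1 *: (a - b - mu *: e).
have H1 := strong_convexity_grad y (e - p).
have H2 := descent x (- p).
have E : y + (e - p) = x - p by rewrite /e addrA [y + _]addrC subrK.
have := le_trans H1; rewrite E => /(_ _ H2).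
have -> : x - a - (y - b) = e - (a - b) by apply/rowP => i; rewrite !mxE; ring.
clearbody e.
rewrite -/a -/b /p !dotE !(dotC e) !(dotC b a) -subr_ge0 => {}E.
by apply: le_trans E _; rewrite le_eqVlt; apply/predU1P; left; field.
Qed.
End Interpolation.

(** * The step matrix of ITEM and its antitranspose *)

Section StepMatrix.
Variables (R : realType) (mu : R).

(** The factor by which the momentum before step [j] survives that step. *)
Definition carry j : R := item_beta mu j * (1 - mu * item_delta mu j).

(** The last iterate of the method is [z_N], which amounts to [beta_N = 0]. *)
Definition fresh N k : R := if (k.+1 < N)%N then 1 - item_beta mu k.+1 else 1.

Definition item_coef N k m : R :=
  (k == m)%:R
  + fresh N k * (item_delta mu m - 1) * \prod_(m.+1 <= j < k.+1) carry j.

Definition item_mx N : 'M[R]_N.+1 :=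
  \matrix_(n, i) if (i < n)%N then item_coef N n.-1 i else 0.

(** The vector [x_k - z_{k+1}] of ITEM, as a combination of oracle responses. *)
Definition momentum (V : lmodType R) (s : nat -> V) k : V :=
  \sum_(i < k.+1)
    ((item_delta mu i - 1) * \prod_(i.+1 <= j < k.+1) carry j) *: s i.

Lemma momentumS (V : lmodType R) (s : nat -> V) k :
  momentum s k.+1
    = carry k.+1 *: momentum s k + (item_delta mu k.+1 - 1) *: s k.+1.
Proof.
rewrite /momentum big_ord_recr /= big_geq // mulr1; congr (_ + _).
rewrite scaler_sumr; apply: eq_bigr => i _.
by rewrite scalerA (big_nat_recr k.+1) //= ?ltnS 1?ltnW // mulrA mulrC.
Qed.

(** By induction on [k], with [y_k - z_k = beta_k (x_{k-1} - z_k)]. *)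
Lemma item_yzS p (y0 : 'rV[R]_p) (s : nat -> 'rV[R]_p) k :
  let yz := item_yz mu y0 s in
  (yz k.+1).2 = (yz k).1 - s k - momentum s k /\
  (yz k.+1).1 = (yz k).1 - s k - (1 - item_beta mu k.+1) *: momentum s k.
Proof.
move=> yz; suff z : (yz k.+1).2 = (yz k).1 - s k - momentum s k.
  split=> //; move: z; rewrite /yz /=; case: item_yz => y z /= ->.
  by apply/rowP => i; rewrite !mxE; ring.
elim: k => [|k IH].
  rewrite /yz /= /momentum big_ord1 big_geq // mulr1.
  by apply/rowP => i; rewrite !mxE; ring.
move: IH; rewrite momentumS /carry /yz /=; case: item_yz => y z /= ->.
by apply/rowP => i; rewrite !mxE; ring.
Qed.

Lemma item_iterateS N p (y0 : 'rV[R]_p) (s : nat -> 'rV[R]_p) k : (k < N)%N ->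
  item_iterate mu N y0 s k.+1
  = item_iterate mu N y0 s k - s k - fresh N k *: momentum s k.
Proof.
move=> kN; have [z y] := item_yzS y0 s k.
rewrite /item_iterate /fresh kN; case: ltnP => [_|Nk]; first exact: y.
by have -> : N = k.+1 by [apply/eqP; rewrite eqn_leq Nk]; rewrite scale1r.
Qed.

Lemma item_coef_sum N (V : lmodType R) (s : nat -> V) k :
  \sum_(i < k.+1) item_coef N k i *: s i = s k + fresh N k *: momentum s k.
Proof.
rewrite /item_coef; under eq_bigr do rewrite scalerDl.
rewrite big_split; congr (_ + _); last first.
  by rewrite /momentum scaler_sumr; apply: eq_bigr => i _; rewrite scalerA mulrA.
rewrite big_ord_recr /= eqxx scale1r big1 ?add0r // => i _.
by rewrite gtn_eqF // scale0r.
Qed.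

Lemma item_mxP N : item_matrix mu (item_mx N).
Proof.
split=> [i j ij|n n0]; first by rewrite mxE ltnNge ij.
have nN : (n <= N)%N by rewrite -ltnS.
case: n n0 nN => -[//|k] kN _ /= kN'; rewrite item_iterateS //.
rewrite -addrA -opprD -item_coef_sum; congr (_ - _).
rewrite (big_ord_widen N.+1 (fun i => item_coef N k i *: _ i)) //; last exact: ltnW.
by apply: eq_bigr => i ik; rewrite mxE ik.
Qed.

Definition mix (V : lmodType R) k (g G : V) : V :=
  (1 - item_beta mu k) *: g + carry k *: G.

Fixpoint dual_momentum N (V : lmodType R) (g : nat -> V) t : V :=
  if t is t'.+1 then mix (N - t) (g t) (dual_momentum N g t') else g 0%N.

(** Each step of the recursion lowers the first index of the products by one,
    whereas in [momentum] it raises the last one: this is the adjoint recursion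
    in reversed time. *)
Lemma dual_momentumE N (V : lmodType R) (g : nat -> V) t : (t < N)%N ->
  dual_momentum N g t
  = \sum_(i < t.+1) (fresh N (N - i.+1)
      * \prod_((N - t.+1).+1 <= j < (N - i.+1).+1) carry j) *: g i.
Proof.
elim: t => [|t IH] tN.
  by rewrite big_ord1 big_geq // mulr1 /fresh subnSK // subn0 ltnn scale1r.
rewrite big_ord_recr /= /mix IH 1?ltnW // [LHS]addrC; congr (_ + _).
  rewrite scaler_sumr; apply: eq_bigr => i _; rewrite scalerA.
  rewrite [in RHS]subnSK // [in RHS]big_ltn; last by rewrite ltnS leq_sub2l // ltnW.
  by rewrite (subnSK (ltnW tN)) mulrCA.
rewrite big_geq // mulr1 /fresh subnSK // ifT //.
by rewrite ltn_subrL /= (leq_ltn_trans _ tN).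
Qed.

(** Entry [(n, i)] of the antitranspose is [item_coef N (N - i - 1) (N - n)]: the
    factor [delta - 1] depends on the row only and comes out of the sum. *)
Lemma antitr_item_sum N (V : lmodType R) (g : nat -> V) (n : 'I_N.+1) :
  (0 < n)%N ->
  \sum_(i < N.+1 | (i < n)%N) antitr (item_mx N) n i *: g i
  = g n.-1 + (item_delta mu (N - n) - 1) *: dual_momentum N g n.-1.
Proof.
case: n => -[//|t] tN1 _ /=; have tN : (t < N)%N := tN1.
pose c i := item_coef N (N - i.+1)%N (N - t.+1)%N.
transitivity (\sum_(i < t.+1) c i *: g i).
  rewrite (big_ord_widen N.+1 (fun i => c i *: g i)) 1?ltnW //.
  apply: eq_bigr => i it; rewrite !mxE /= !subSS ltn_sub2l ?(leq_trans it) //.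
  by rewrite -subnS.
rewrite dual_momentumE // scaler_sumr /c /item_coef.
under eq_bigr do rewrite scalerDl.
rewrite big_split; congr (_ + _).
  rewrite big_ord_recr /= eqxx scale1r big1 ?add0r // => i _.
  rewrite gtn_eqF ?scale0r //; apply: ltn_sub2l; last exact: ltn_ord.
  exact: leq_ltn_trans (ltn_ord i) tN.
by apply: eq_bigr => i _; rewrite scalerA mulrCA mulrA.
Qed.

End StepMatrix.

(** * The coefficients of ITEM *)

Section ItemScalars.
Variables (R : realType) (mu : R).
Hypotheses (hmu0 : 0 < mu) (hmu1 : mu < 1).
Implicit Types k : nat.

Local Notation A := (itemA mu).
(* In terms of these two numbers all coefficients are rational in [A k] and
   [A k.+1]: delta_k = 2 A_{k+1} / S_k, 1 - mu delta_k = K_k / S_k and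
   1 - beta_k = K_k / ((1 - mu) A_{k+1}). *)
Local Notation K k := ((1 - mu) * A k.+1 - A k).
Local Notation S k := ((1 + mu) * A k.+1 - A k).

Lemma itemA_ge0 k : 0 <= A k.
Proof.
elim: k => //= k IH; apply: divr_ge0; last by rewrite sqr_ge0.
apply: addr_ge0; first by rewrite mulr_ge0 // addr_ge0 // ltW.
by rewrite mulr_ge0 // addr_ge0 // sqrtr_ge0.
Qed.

Lemma itemA_gap k : A k + 2 < (1 - mu) * A k.+1.
Proof.
have A0 := itemA_ge0 k; have m1 : 0 < 1 - mu by rewrite subr_gt0.
rewrite /= [_ * (_ / _)](_ : _ = ((1 + mu) * A k
  + 2 * (1 + Num.sqrt ((1 + A k) * (1 + mu * A k)))) / (1 - mu)); last first.
  by field; rewrite gt_eqF.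
rewrite ltr_pdivlMr //.
have r0 := sqrtr_ge0 ((1 + A k) * (1 + mu * A k)).
have := mulr_ge0 (ltW hmu0) A0; have := hmu0; lra.
Qed.

Lemma itemA_gt0 k : 0 < A k.+1.
Proof.
have := itemA_gap k; have A0 := itemA_ge0 k.
rewrite -(@pmulr_rgt0 _ (1 - mu)) ?subr_gt0 //; lra.
Qed.

Lemma itemA_lt k : A k < A k.+1.
Proof.
have := itemA_gap k; have := mulr_gt0 hmu0 (itemA_gt0 k); lra.
Qed.

Lemma item_K_gt0 k : 0 < K k.
Proof. by have := itemA_gap k; lra. Qed.

Lemma item_S_gt0 k : 0 < S k.
Proof. have := item_K_gt0 k; have := mulr_gt0 hmu0 (itemA_gt0 k); lra. Qed.

(** The quadratic equation whose larger root is [A k.+1]. *)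
Lemma item_K_sqr k : K k ^+ 2 = 4 * A k.+1 * (1 + mu * A k).
Proof.
have A0 := itemA_ge0 k; have m1 : 1 - mu != 0 by rewrite subr_eq0 gt_eqF.
have := sqr_sqrtr (mulr_ge0 (addr_ge0 ler01 A0)
  (addr_ge0 ler01 (mulr_ge0 (ltW hmu0) A0))).
rewrite /=; set r := Num.sqrt _ => rE.
apply/eqP; rewrite -subr_eq0; apply/eqP.
transitivity (4 / (1 - mu) ^+ 2 * (r ^+ 2 - (1 + A k) * (1 + mu * A k))).
  by field.
by rewrite rE subrr mulr0.
Qed.

Lemma item_S_sqr k : S k ^+ 2 = 4 * A k.+1 * (1 + mu * A k.+1).
Proof.
by transitivity (K k ^+ 2 + 4 * mu * A k.+1 * (A k.+1 - A k));
  [ring|rewrite item_K_sqr; ring].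
Qed.

Lemma item_deltaE k : item_delta mu k = 2 * A k.+1 / S k.
Proof.
have A0 := itemA_gt0 k; have S0 := item_S_gt0 k.
have m0 : 0 < 1 + mu * A k.+1 by rewrite addr_gt0 // mulr_gt0.
rewrite /item_delta -[RHS]gtr0_norm; last by rewrite divr_gt0 // mulr_gt0.
rewrite -sqrtr_sqr; congr Num.sqrt.
by rewrite expr_div_n item_S_sqr; field; rewrite !gt_eqF.
Qed.

End ItemScalars.

(** * The Lyapunov function *)

Section Energy.
Variables (R : realType) (d : nat) (mu : R).
Hypotheses (hmu0 : 0 < mu) (hmu1 : mu < 1).
Implicit Types (G g e : 'rV[R]_d) (F : R).

Local Notation A := (itemA mu).
Local Notation kappa := (mu / (2 * (1 - mu))).

Definition weight k : R := (1 - mu) / (4 * (1 + mu * A k)).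

(** For the dual method this is [x_t - x_{t+1}], where [k = N - t - 1]. *)
Definition displacement k g G : 'rV[R]_d := g + (item_delta mu k - 1) *: G.

(** With [phi] the proximal function, [sigma = 2 kappa], [e = x_t - x_N] and [F]
    the difference of the values of [phi] at [x_t] and [x_N], this is the value at
    [x_t], minus that at [x_N], of the convex function [phi - sigma/2 |.|^2],
    minus [<G - sigma x_t, e>].  It is affine in [G]. *)
Definition gap F e G : R := F - dot G e + kappa * dot e e.

(** Once the weights are written as [(1 - mu) A_{k+1}] over the squares of
    [(1 + mu) A_{k+1} - A_k] and [(1 - mu) A_{k+1} - A_k], this is an identity of
    rational functions. *)
Lemma energy_balance k g G (D := displacement k g G) :
  weight k.+1 * dot G G - weight k * dot (mix mu k g G) (mix mu k g G)
  = (A k.+1)^-1 * (dot (G - g) D - 2 * kappa * dot D D).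
Proof.
have [A0 A1] := (itemA_ge0 hmu0 k, itemA_gt0 hmu0 hmu1 k).
have [K0 S0] := (item_K_gt0 hmu0 hmu1 k, item_S_gt0 hmu0 hmu1 k).
have m1 : 1 - mu != 0 by rewrite subr_eq0 gt_eqF.
have wS : weight k.+1 = (1 - mu) * A k.+1 / ((1 + mu) * A k.+1 - A k) ^+ 2.
  rewrite item_S_sqr // /weight; field.
  by rewrite !gt_eqF // addr_gt0 // mulr_gt0.
have wK : weight k = (1 - mu) * A k.+1 / ((1 - mu) * A k.+1 - A k) ^+ 2.
  rewrite item_K_sqr // /weight; field.
  by rewrite !gt_eqF // ltr_pwDl // mulr_ge0 // ltW.
rewrite {}wS {}wK /D /mix /carry /displacement item_deltaE // /item_beta.
rewrite !dotE (dotC g G).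
move: (dot G G) (dot G g) (dot g g) => p q r.
field.
by rewrite m1 !gt_eqF.
Qed.

(** Moving from [x_t] to [x_{t+1}] while keeping the slope [G - sigma x_t] fixed
    turns [G] into [G - sigma D]. *)
Lemma potential_half_step k g G e F F' (D := displacement k g G) :
  0 <= F - F' - dot g D - kappa * dot D D ->
  weight k * dot (mix mu k g G) (mix mu k g G)
    + (A k.+1)^-1 * gap F' (e - D) (G - (2 * kappa) *: D)
  <= weight k.+1 * dot G G + (A k.+1)^-1 * gap F e G.
Proof.
move=> I; have := energy_balance k g G; rewrite -/D => E.
rewrite -subr_ge0.
have A1 : 0 <= (A k.+1)^-1 by rewrite invr_ge0 itemA_ge0.
have := mulr_ge0 A1 I; congr (_ <= _); move: E; rewrite /gap.
set P := weight _ * _; set Q := weight _ * _.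
clearbody D; rewrite !dotE !(dotC e) => /eqP; rewrite subr_eq => /eqP ->.
ring.
Qed.

(** The averaging that defines [G_{t+1}] from [G_t]: the weights [1 / A_{N-t}]
    accumulate, and their increment goes to the new gradient. *)
Lemma mix_average k g G (D := displacement k g G) : (0 < k)%N ->
  (A k)^-1 *: mix mu k g G
  = (A k.+1)^-1 *: (G - (2 * kappa) *: D) + ((A k)^-1 - (A k.+1)^-1) *: g.
Proof.
move=> k0; have A0 : A k != 0 by case: k k0 {D} => // k _; rewrite gt_eqF ?itemA_gt0.
have A1 := itemA_gt0 hmu0 hmu1 k; have S0 := item_S_gt0 hmu0 hmu1 k.
have m1 : 1 - mu != 0 by rewrite subr_eq0 gt_eqF.
rewrite /D /mix /carry /displacement item_deltaE // /item_beta.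
apply/rowP => i; rewrite !mxE; field.
by rewrite m1 A0 !gt_eqF.
Qed.

(** The new gradient enters the average with a nonnegative weight and a
    nonpositive gap. *)
Lemma potential_step k g G e F F' (D := displacement k g G) : (0 < k)%N ->
  0 <= F - F' - dot g D - kappa * dot D D ->
  gap F' (e - D) g <= 0 ->
  weight k * dot (mix mu k g G) (mix mu k g G)
    + (A k)^-1 * gap F' (e - D) (mix mu k g G)
  <= weight k.+1 * dot G G + (A k.+1)^-1 * gap F e G.
Proof.
move=> k0 I J; apply: le_trans (potential_half_step e I); rewrite lerD2l.
have gapE v : (A k)^-1 * gap F' (e - D) v
    = (A k)^-1 * (F' + kappa * dot (e - D) (e - D)) - dot ((A k)^-1 *: v) (e - D).
  by rewrite dotZl /gap; ring.
rewrite gapE mix_average // -/D.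
have W : 0 <= (A k)^-1 - (A k.+1)^-1.
  rewrite subr_ge0 lef_pV2 ?posrE ?itemA_gt0 // ?ltW ?itemA_lt //.
  by case: k k0 {I J D gapE} => // k _; exact: itemA_gt0.
have := mulr_ge0_le0 W J; rewrite -subr_ge0 -[_ <= _ in X in _ -> X]subr_ge0.
congr (_ <= _); rewrite /gap; clearbody D; set e' := e - D; clearbody e'.
rewrite !dotE; ring.
Qed.

End Energy.

(** * The rate of the dual method *)

(** At [t = N] the inverse of [A_0 = 0] is 0 by convention, so that only the
    squared norm of [G_N] remains. *)
Lemma dual_item_potential (R : realType) (N : nat) (mu : R)
    (hmu0 : 0 < mu) (hmu1 : mu < 1) (d : nat) (h : 'rV[R]_d -> R)
    (hsmooth : smooth 1 h) (hconvex : strongly_convex mu h)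
    (y : nat -> 'rV[R]_d) (g := fun t => grad h (y t))
    (G := dual_momentum mu N g)
    (hy : forall t, (t < N)%N ->
      y t.+1 = y t - (g t + (item_delta mu (N - t.+1) - 1) *: G t)) t :
  (t <= N)%N ->
  weight mu (N - t) * dot (G t) (G t)
    + (itemA mu (N - t))^-1
      * gap mu (prox_value h (y t) - prox_value h (y N))
          (prox h (y t) - prox h (y N)) (G t)
  <= weight mu N * dot (g 0%N) (g 0%N).
Proof.
have J s : gap mu (prox_value h (y s) - prox_value h (y N))
    (prox h (y s) - prox h (y N)) (g s) <= 0.
  have := interpolation hmu1 hsmooth hconvex (y N) (y s).
  rewrite /gap -/(g s) -[prox h (y N) - _]opprB.
  set e := prox _ _ - _; clearbody e; rewrite !dotE; lra.
elim: t => [_|t IH tN].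
  rewrite subn0 gerDl; apply: mulr_ge0_le0 (J 0%N).
  by rewrite invr_ge0 itemA_ge0.
apply: le_trans (IH (ltnW tN)).
have Nt : (N - t = (N - t.+1).+1)%N by rewrite subnSK.
rewrite Nt; set k := (N - t.+1)%N.
have GE : G t.+1 = mix mu k (g t.+1) (G t) by [].
have DE : prox h (y t) - prox h (y t.+1) = displacement mu k (g t.+1) (G t).
  by rewrite /prox -/(g t) -/(g t.+1) hy // /displacement -/k;
    apply/rowP => i; rewrite !mxE; ring.
have eE : prox h (y t.+1) - prox h (y N)
    = prox h (y t) - prox h (y N) - displacement mu k (g t.+1) (G t).
  by rewrite -DE; apply/rowP => i; rewrite !mxE; ring.
have I := interpolation hmu1 hsmooth hconvex (y t) (y t.+1).
rewrite DE -/(g t.+1) in I.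
have {}I : 0 <= prox_value h (y t) - prox_value h (y N)
    - (prox_value h (y t.+1) - prox_value h (y N))
    - dot (g t.+1) (displacement mu k (g t.+1) (G t))
    - mu / (2 * (1 - mu))
      * dot (displacement mu k (g t.+1) (G t))
          (displacement mu k (g t.+1) (G t)).
  by apply: le_trans I _; lra.
rewrite GE eE; have [k0|k0] := posnP k; last first.
  by apply: potential_step => //; rewrite -eE.
(* In the last step the averaging is replaced by the vanishing of the gap, as
   [y_{t+1}] is [y_N] itself. *)
have tE : t.+1 = N by apply/eqP; rewrite eqn_leq tN -subn_eq0 -/k k0.
have half := potential_half_step hmu0 hmu1 (prox h (y t) - prox h (y N)) I.
apply: le_trans half; rewrite -eE tE !subrr /gap.
by rewrite [in X in X^-1 * _]k0 /= invr0 -(scale0r (0 : 'rV[R]_d)) !dotE; lra.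
Qed.

Theorem mainTheorem7 (R : realType) (N : nat) (mu : R) (H : 'M[R]_N.+1)
    (hN : (0 < N)%N) (hmu0 : 0 < mu) (hmu1 : mu < 1)
    (hH : item_matrix mu H)
    (d : nat) (hd : (0 < d)%N) (h : 'rV[R]_d -> R)
    (hsmooth : smooth 1 h) (hconvex : strongly_convex mu h)
    (y : nat -> 'rV[R]_d)
    (hy : fsfom_iterates (antitr H) (fun i => grad h (y i)) y) :
  enorm (grad h (y N)) ^+ 2
    <= 1 / (1 + mu * itemA mu N) * enorm (grad h (y 0%N)) ^+ 2.
Proof.
pose g t := grad h (y t).
have rec t : (t < N)%N ->
    y t.+1 = y t
      - (g t + (item_delta mu (N - t.+1) - 1) *: dual_momentum mu N g t).
  move=> tN; have nN : (t.+1 < N.+1)%N by [].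
  have := hy (Ordinal nN) isT; rewrite (item_matrix_unique hH (item_mxP mu N)).
  by rewrite (antitr_item_sum _ g (n := Ordinal nN)).
have := dual_item_potential hmu0 hmu1 hsmooth hconvex rec (leqnn N).
have -> : dual_momentum mu N g N = g N.
  (* [beta_0 = 0] because [A_0 = 0]. *)
  case: N {H hH hy rec} hN => // n _ /=.
  by rewrite subnn /mix /carry /item_beta /= !mul0r subr0 scale1r scale0r addr0.
rewrite subnn /= invr0 mul0r addr0 !enorm_sqr -/(g N) -/(g 0%N) /weight /=.
have A0 := itemA_ge0 hmu0 N.
have m0 : 0 < 1 + mu * itemA mu N by rewrite ltr_pwDl // mulr_ge0 // ltW.
have m1 : 0 < 1 - mu by rewrite subr_gt0.
rewrite mulr0 addr0 mulr1 => le; rewrite -(@ler_pM2l _ ((1 - mu) / 4)) ?divr_gt0 //.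
apply: le_trans le _; rewrite le_eqVlt; apply/predU1P; left; field.
by rewrite gt_eqF.
Qed.
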